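(* Let $F:[0,1]\to\mathbb{R}$ be a continuous function, and let $u_n:\mathbb{T}_m\to\mathbb{R}$, $n\in\mathbb{N}$, be the approximating functions associated with $F$ defined in the context. Then the sequence $\{u_n\}_{n\in\mathbb{N}}$ converges uniformly on $\mathbb{T}_m$ to the solution $u$ of $(DP)$ with boundary data $F$. Moreover, if $F$ is Lipschitz with Lipschitz constant $L$, then $$|u_n(x)-u(x)|\le\frac{L}{m^n}$$ for all $x\in\mathbb{T}_m$ (and all $n\in\mathbb{N}$).
   Context: Let $m>2$ be an integer, $\mathbb{N}=\{1,2,\dots\}$, and let $\alpha,\beta>0$ with $\alpha+\beta=1$. The directed tree $\mathbb{T}_m$ consists of the empty sequence $\emptyset$ (the root) and all finite sequences $(a_1,\dots,a_k)$, $k\in\mathbb{N}$, with $a_i\in\{0,1,\dots,m-1\}$ (vertices). The set $\mathcal{S}(x)$ of successors of $x$ consists of the $m$ vertices obtained by appending one coordinate to $x$. For a vertex $x=(a_1,\dots,a_k)$ put $\psi(x)=\sum_{i=1}^ka_im^{-i}$ and $I_x=[\psi(x),\psi(x)+m^{-k}]$; $I_y\subset I_x$ iff $y=x$ or $y$ is a descendant of $x$. A branch is an infinite sequence $\pi=(x_1,x_2,\dots)$ of vertices $x_k=(a_1,\dots,a_k)$, $\partial\mathbb{T}_m$ is the set of branches, $\psi(\pi)=\sum_{k\ge1}a_km^{-k}\in[0,1]$, and $F(\pi)$ means $F(\psi(\pi))$. A function $u:\mathbb{T}_m\to\mathbb{R}$ is $p$-harmonious if for all $x\in\mathbb{T}_m$,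 $$u(x)=\frac{\alpha}{2}\Big\{\max_{y\in\mathcal{S}(x)}u(y)+\min_{y\in\mathcal{S}(x)}u(y)\Big\}+\frac{\beta}{m}\sum_{y\in\mathcal{S}(x)}u(y).$$ The solution of $(DP)$ with boundary data $F$ (continuous) is the unique bounded $p$-harmonious function $u$ with $\lim_{k\to\infty}u(x_k)=F(\pi)$ for every $\pi=(x_1,x_2,\dots)\in\partial\mathbb{T}_m$. Approximating functions: for $n\in\mathbb{N}$ and $j\in\{0,\dots,m^n-1\}$ let $t_{nj}=j/m^n$ and let $x_{nj}$ be the vertex of length $n$ with $I_{x_{nj}}=[t_{nj},t_{nj}+m^{-n}]$. Define $u_n(y)=F(t_{nj})$ for every vertex $y$ with $I_y\subset I_{x_{nj}}$, $j\in\{0,\dots,m^n-1\}$ (this defines $u_n$ on all vertices of length $\ge n$), and define $u_n$ on vertices $x$ of length $n-1,n-2,\dots,0$ successively by $$u_n(x)=\frac{\alpha}{2}\Big\{\max_{y\in\mathcal{S}(x)}u_n(y)+\min_{y\in\mathcal{S}(x)}u_n(y)\Big\}+\frac{\beta}{m}\sum_{y\in\mathcal{S}(x)}u_n(y).$$ *)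

(* Defs.v *)
From HB Require Import structures.
From mathcomp Require Import all_boot all_order all_algebra.
From mathcomp Require Import all_classical all_reals all_analysis.
From mathcomp Require Import ring lra.
Set Implicit Arguments.
Unset Strict Implicit.
Unset Printing Implicit Defensive.
Import Order.TTheory GRing.Theory Num.Theory.
Import numFieldNormedType.Exports.
Local Open Scope classical_set_scope.
Local Open Scope ring_scope.

(* The vertices of the m-ary directed tree are the finite sequences over
   {0, ..., m-1}; the root is the empty sequence. *)
Notation vertex m := (seq 'I_m).

Section Tree.
Context {R : realType} {m : nat}.
Implicit Types (x y : vertex m) (u v : vertex m -> R).

Definition succs x : seq (vertex m) := [seq rcons x a | a <- enum 'I_m].

(* Maximum and minimum of a nonempty list; the head only serves as the initial
   value, so that no extraneous default interferes. *)
Definition lmax (s : seq R) : R := \big[Num.max/head 0 s]_(a <- s) a.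
Definition lmin (s : seq R) : R := \big[Num.min/head 0 s]_(a <- s) a.

Definition dp_op (alpha beta : R) u x : R :=
  alpha / 2 * (lmax [seq u y | y <- succs x] + lmin [seq u y | y <- succs x])
  + beta / m%:R * \sum_(y <- succs x) u y.

Definition p_harmonious (alpha beta : R) u : Prop :=
  forall x, u x = dp_op alpha beta u x.

(* Digits are numbered from 0 here, whence the exponent i.+1. *)
Definition psi x : R :=
  \sum_(i < size x) (nth 0%N [seq val a | a <- x] i)%:R / m%:R ^+ i.+1.

Definition vertex_itv x : set R :=
  `[psi x, psi x + m%:R ^- size x].

(* A branch is encoded by the digit sequence (a_1, a_2, ...), a_{i+1} = b i;
   its k-th vertex is [branch_vertex b k]. *)
Definition branch_vertex (b : nat -> 'I_m) (k : nat) : vertex m := mkseq b k.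

Definition branch_psi (b : nat -> 'I_m) : R :=
  limn (series (fun i => (b i)%:R / m%:R ^+ i.+1 : R)).

(* Only the values of F on [0, 1] matter. *)
Definition dp_solution (alpha beta : R) (F : R -> R) u : Prop :=
  [/\ bounded_fun u,
      p_harmonious alpha beta u &
      forall b : nat -> 'I_m,
        u (branch_vertex b k) @[k --> \oo] --> F (branch_psi b)].

(* At depth at least n the ancestor of y of length n is [take n y], and its
   left endpoint is t_nj; the n - size x applications of [dp_op] fill the
   levels n-1, ..., 0 (see [approximant_deep] and [approximant_shallow]). *)
Definition approximant (alpha beta : R) (F : R -> R) (n : nat) x : R :=
  iter (n - size x) (dp_op alpha beta) (fun y => F (psi (take n y))) x.

Lemma psi_nil : psi [::] = 0.
Proof. by rewrite /psi big_ord0. Qed.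

Lemma psi_cons a x : psi (a :: x) = ((a : nat)%:R + psi x) / m%:R.
Proof.
rewrite /psi big_ord_recl /= expr1 mulrDl; congr (_ + _).
rewrite mulr_suml; apply: eq_bigr => i _.
by rewrite -mulrA -invfM -exprSr.
Qed.

Lemma psi_cat x y : psi (x ++ y) = psi x + psi y / m%:R ^+ size x.
Proof.
elim: x => [|a x IH] /=; first by rewrite psi_nil add0r expr0 divr1.
by rewrite !psi_cons IH exprSr invfM !mulrDl !mulrA addrA.
Qed.

Lemma psi_ge0 x : 0 <= psi x.
Proof. by apply: sumr_ge0 => i _; rewrite divr_ge0 ?exprn_ge0. Qed.

Lemma psi_lt1 x : (1 < m)%N -> psi x < 1.
Proof.
move=> m1; have m0 : 0 < m%:R :> R by rewrite ltr0n; apply: ltn_trans m1.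
elim: x => [|a x IH]; first by rewrite psi_nil.
rewrite psi_cons ltr_pdivrMr // mul1r.
have : (a : nat)%:R + 1 <= m%:R :> R by rewrite natr1 ler_nat.
lra.
Qed.

Lemma psi_numerator x : (1 < m)%N ->
  exists k : nat, psi x = k%:R / m%:R ^+ size x.
Proof.
move=> m1; have m0 : m%:R != 0 :> R.
  by rewrite pnatr_eq0 -lt0n; apply: ltn_trans m1.
elim: x => [|a x [k IH]]; first by exists 0%N; rewrite psi_nil mul0r.
exists (a * m ^ size x + k)%N.
rewrite psi_cons IH /= natrD natrM natrX exprSr invfM [in RHS]mulrDl !mulrA.
by rewrite mulfK ?expf_neq0 // mulrDl.
Qed.

Lemma vertex_itv_psi x (s t : R) : s <= t -> vertex_itv x = [set` `[s, t]] ->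
  psi x = s.
Proof.
move=> st E; apply/eqP; rewrite eq_le; apply/andP; split.
  have : [set` `[s, t]] s by rewrite /= in_itv /= lexx.
  by rewrite -E /vertex_itv /= in_itv /= => /andP[].
have : vertex_itv x (psi x).
  by rewrite /vertex_itv /= in_itv /= lexx lerDl invr_ge0 exprn_ge0.
by rewrite E /= in_itv /= => /andP[].
Qed.

Lemma approximant_deep (alpha beta : R) (F : R -> R) (n j : nat) x y :
  (1 < m)%N -> size x = n ->
  vertex_itv x =
    [set` `[j%:R / m%:R ^+ n, j%:R / m%:R ^+ n + m%:R ^- n]] ->
  vertex_itv y `<=` vertex_itv x ->
  approximant alpha beta F n y = F (j%:R / m%:R ^+ n).
Proof.
move=> m1 sx xj yx.
have m0 : 0 < m%:R :> R by rewrite ltr0n; apply: ltn_trans m1.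
have p k : 0 < m%:R ^+ k :> R by rewrite exprn_gt0.
have q k : 0 < m%:R ^- k :> R by rewrite invr_gt0.
have <- : psi x = j%:R / m%:R ^+ n.
  by apply: vertex_itv_psi xj; rewrite lerDl ltW.
have : vertex_itv x (psi y).
  by apply: yx; rewrite /vertex_itv /= in_itv /= lexx lerDl ltW.
rewrite /vertex_itv /= in_itv /= sx => /andP[l1 _].
have : vertex_itv x (psi y + m%:R ^- size y).
  by apply: yx; rewrite /vertex_itv /= in_itv /= lexx andbT lerDl ltW.
rewrite /vertex_itv /= in_itv /= sx => /andP[_ l2].
have ny : (n <= size y)%N.
  have : m%:R ^- size y <= m%:R ^- n :> R by lra.
  by rewrite lef_pV2 ?posrE // ler_eXn2l ?ltr1n.
rewrite /approximant (eqP (ny : (n - size y == 0)%N)) /=; congr F.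
have st : size (take n y) = n by rewrite size_takel.
have := psi_cat (take n y) (drop n y); rewrite cat_take_drop st => E.
have d0 : 0 <= psi (drop n y) / m%:R ^+ n by rewrite mulr_ge0 ?psi_ge0 ?ltW.
have d1 : psi (drop n y) / m%:R ^+ n < m%:R ^- n.
  by rewrite -[ltRHS]mul1r ltr_pM2r ?psi_lt1.
have [k Ek] := psi_numerator (take n y) m1.
have [k' Ek'] := psi_numerator x m1.
rewrite st in Ek; rewrite sx in Ek'.
have h1 : psi x < psi (take n y) + m%:R ^- n by lra.
have h2 : psi (take n y) < psi x + m%:R ^- n.
  by have := q (size y); lra.
move: h1 h2; rewrite Ek Ek' -[X in _ + X]mul1r -mulrDl ltr_pM2r // natr1 ltr_nat.
rewrite -[X in _ + X]mul1r -mulrDl ltr_pM2r // natr1 ltr_nat !ltnS => a b.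
by have /eqP-> : k == k' by rewrite eqn_leq a b.
Qed.

Lemma approximant_shallow (alpha beta : R) (F : R -> R) (n : nat) x :
  (size x < n)%N ->
  approximant alpha beta F n x = dp_op alpha beta (approximant alpha beta F n) x.
Proof.
move=> xn; rewrite {1}/approximant; have -> : (n - size x = (n - (size x).+1).+1)%N.
  by rewrite subnSK.
rewrite iterS /dp_op; set v := iter _ _ _.
have E y : y \in succs x -> v y = approximant alpha beta F n y.
  by move=> /mapP[a _ ->]; rewrite /approximant size_rcons.
have -> : [seq v y | y <- succs x] =
          [seq approximant alpha beta F n y | y <- succs x] by apply/eq_in_map.
by congr (_ + _ * _); apply: eq_big_seq.
Qed.

End Tree.

(* Main.v *)
Require Import Defs.
From HB Require Import structures.
From mathcomp Require Import all_boot all_order all_algebra.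
From mathcomp Require Import all_classical all_reals all_analysis.
From mathcomp Require Import lra.
Set Implicit Arguments.
Unset Strict Implicit.
Unset Printing Implicit Defensive.
Import Order.TTheory GRing.Theory Num.Theory.
Import numFieldNormedType.Exports.
Local Open Scope classical_set_scope.
Local Open Scope ring_scope.

(* The averaging operator is monotone and commutes with adding constants, so two
   p-harmonious functions that differ by at most e on all deep levels differ by
   at most e everywhere. Each u_n is p-harmonious on the whole tree, and below
   level k >= n the difference u_n - u_k is an increment of F over a distance of
   at most m^-n; hence |u_n - u_k| is bounded by the modulus of continuity of F
   at m^-n, which makes (u_n) uniformly Cauchy and gives the Lipschitz rate.
   Uniqueness: a positive difference of two solutions at a vertex persists along
   some branch, contradicting the equality of the boundary values. *)

(** * Bounds for the maximum and minimum of a finite list *)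

Section ListExtrema.
Context {R : realType}.
Implicit Types (s : seq R) (c : R).

Lemma lmax_ge s c : c \in s -> c <= lmax s.
Proof. by move=> cs; exact: le_bigmax_seq. Qed.

Lemma lmin_le s c : c \in s -> lmin s <= c.
Proof. by move=> cs; exact: ge_bigmin_seq. Qed.

Lemma lmax_le s c : (0 < size s)%N -> {in s, forall a, a <= c} -> lmax s <= c.
Proof.
move=> s0 sc; rewrite /lmax big_seq; apply: bigmax_le => //.
by apply: sc; case: s s0 => // a s _; rewrite mem_head.
Qed.

Lemma lmin_ge s c : (0 < size s)%N -> {in s, forall a, c <= a} -> c <= lmin s.
Proof.
move=> s0 sc; rewrite /lmin big_seq; apply: le_bigmin => //.
by apply: sc; case: s s0 => // a s _; rewrite mem_head.
Qed.

End ListExtrema.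

(** * Uniform continuity and limits of real sequences *)

(** Heine-Cantor, from the near-covering form of compactness: a threshold for [d] valid near each
    point of [A] yields one valid on all of [A]. *)
Lemma compact_unif_continuous {R : realType} (A : set R) (F : R -> R) (e : R) :
  compact A -> {within A, continuous F} -> 0 < e ->
  exists2 d, 0 < d &
    forall s t, A s -> A t -> `|s - t| <= d -> `|F s - F t| <= e.
Proof.
move=> /compact_near_coveringP cA /subspace_continuousP cF e0.
pose P (d s : R) := forall t, A s -> A t -> `|s - t| <= d -> `|F s - F t| <= e.
have : \forall d \near 0^'+, A `<=` P d.
  apply: cA => x Ax.
  have e2 : 0 < e / 2 by lra.
  have := cF x Ax; move=> /cvgrPdist_le /(_ _ e2).
  rewrite /within /= => /nbhs_ballP[r /= r0 xr].
  have r2 : 0 < r / 2 by lra.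
  (* Halving [r] keeps both [s] and any [t] within [d] of it inside the ball of radius [r] at [x],
     where [F] stays within [e / 2] of [F x]. *)
  exists (ball x (r / 2), [set d | d < r / 2]); first split => /=.
  - exact: nbhsx_ballx.
  - exact: nbhs_right_lt.
  - move=> [s d] /= [xs dr] t As At st.
    have xs' : `|F x - F s| <= e / 2.
      by apply: xr As; apply: le_ball xs; lra.
    have xt : `|F x - F t| <= e / 2.
      apply: xr At; move: xs; rewrite /ball /= => xs.
      rewrite (le_lt_trans (ler_distD s _ _)) //; lra.
    rewrite (le_trans (ler_distD (F x) _ _)) // distrC; lra.
move=> Pd; near (0 : R)^'+ => d; exists d; first by near: d; exact: nbhs_right_gt.
move=> s t As At st; suff : A `<=` P d by apply.
by near: d.
Unshelve. all: by end_near. Qed.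

Lemma cvgn_cauchy_le {R : realType} (a : R ^nat) :
  (forall e, 0 < e -> exists n, forall k, (n <= k)%N -> `|a n - a k| <= e) ->
  cvgn a.
Proof.
move=> ca; apply/cauchy_cvgP/cauchy_exP => e e0.
have e2 : 0 < e / 2 by lra.
have [n an] := ca _ e2; exists (a n).
by exists n => // k /= nk; rewrite /ball /= (le_lt_trans (an k nk)) //; lra.
Qed.

(** Letting [k] tend to infinity turns a Cauchy estimate into an error bound with the same constant;
    this keeps the Lipschitz rate sharp. *)
Lemma norm_sub_limn_le {R : realType} (a : R ^nat) (n : nat) (e : R) :
  cvgn a -> (forall k, (n <= k)%N -> `|a n - a k| <= e) ->
  `|a n - limn a| <= e.
Proof.
move=> ca an.
have c : (fun k => `|a n - a k|) @ \oo --> `|a n - limn a|.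
  by apply: cvg_norm; apply: cvgB => //; exact: cvg_cst.
rewrite -(cvg_lim (@norm_hausdorff _ _) c); apply: limr_le.
  by apply/cvg_ex; eexists; exact: c.
by exists n => // k /= nk; exact: an.
Qed.

Lemma expfV_small {R : realType} (m : nat) (d : R) : (1 < m)%N -> 0 < d ->
  exists N, forall n, (N <= n)%N -> m%:R ^- n <= d.
Proof.
move=> m1 d0.
have : (GRing.exp (m%:R^-1 : R)) @ \oo --> (0 : R).
  by apply: cvg_expr; rewrite ger0_norm ?invr_ge0 // invf_lt1 ?ltr1n // ltr0n ltnW.
move=> /cvgrPdist_le /(_ _ d0) [N _ Nd]; exists N => n /Nd /=.
by rewrite sub0r normrN exprVn ger0_norm // invr_ge0 exprn_ge0.
Qed.

(** * Base-[m] expansions of vertices and branches *)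

Section Digits.
Context {R : realType} {m : nat}.
Hypothesis m_gt1 : (1 < m)%N.

Lemma psi_itv (x : vertex m) : `[0, 1]%classic (psi x : R).
Proof. by rewrite /= in_itv /= psi_ge0 ltW // psi_lt1. Qed.

(** The dropped digits contribute [psi (drop n x)], a number in [0, 1), scaled by [m^-n]; if [x] is
    shorter than [n], nothing is dropped. *)
Lemma psi_take_dist (n : nat) (x : vertex m) :
  `|psi (take n x) - psi x| <= m%:R ^- n :> R.
Proof.
have [nx|xn] := leqP n (size x); last first.
  by rewrite take_oversize 1?ltnW // subrr normr0 invr_ge0 exprn_ge0.
rewrite -[x in _ - psi x](cat_take_drop n) psi_cat size_takel //.
rewrite opprD addrA subrr sub0r normrN ger0_norm.
  by rewrite -[leRHS]mul1r ler_wpM2r ?invr_ge0 ?exprn_ge0 // ltW // psi_lt1.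
by rewrite mulr_ge0 ?psi_ge0 ?invr_ge0 ?exprn_ge0.
Qed.

Lemma take_branch_vertex (b : nat -> 'I_m) n k : (n <= k)%N ->
  take n (branch_vertex b k) = branch_vertex b n.
Proof.
by move=> nk; rewrite /branch_vertex /mkseq -map_take take_iota (minn_idPl nk).
Qed.

Lemma branch_psiE (b : nat -> 'I_m) :
  branch_psi b = limn (fun k => psi (branch_vertex b k)) :> R.
Proof.
congr (lim (_ @ \oo)); apply/funext => k.
rewrite /series /= big_mkord /psi size_mkseq; apply: eq_bigr => i _.
by rewrite -map_comp nth_mkseq.
Qed.

Lemma psi_branch_dist (b : nat -> 'I_m) n k : (n <= k)%N ->
  `|psi (branch_vertex b n) - psi (branch_vertex b k)| <= m%:R ^- n :> R.
Proof. by move=> nk; rewrite -(take_branch_vertex b nk) psi_take_dist. Qed.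

Lemma is_cvg_psi_branch (b : nat -> 'I_m) :
  cvgn (fun k => psi (branch_vertex b k) : R).
Proof.
apply: cvgn_cauchy_le => e /(expfV_small m_gt1)[N Ne]; exists N => k Nk.
by rewrite (le_trans (psi_branch_dist b Nk)) ?Ne.
Qed.

Lemma branch_psi_dist (b : nat -> 'I_m) n :
  `|psi (branch_vertex b n) - branch_psi b| <= m%:R ^- n :> R.
Proof.
rewrite branch_psiE.
apply: (norm_sub_limn_le (a := fun k => psi (branch_vertex b k))).
  exact: is_cvg_psi_branch.
by move=> k; exact: psi_branch_dist.
Qed.

Lemma branch_psi_itv (b : nat -> 'I_m) : `[0, 1]%classic (branch_psi b : R).
Proof.
rewrite /= in_itv /= branch_psiE; apply/andP; split.
  apply: limr_ge; first exact: is_cvg_psi_branch.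
  by apply: nearW => k; exact: psi_ge0.
apply: limr_le; first exact: is_cvg_psi_branch.
by apply: nearW => k; rewrite ltW // psi_lt1.
Qed.

End Digits.

(** * The averaging operator and comparison of p-harmonious functions *)

Section Harmonic.
Context {R : realType} {m : nat}.
Variables (alpha beta : R).
Hypotheses (m_gt0 : (0 < m)%N) (alpha_ge0 : 0 <= alpha) (beta_ge0 : 0 <= beta).
Hypothesis alphaDbeta : alpha + beta = 1.
Implicit Types (u v : vertex m -> R) (x : vertex m) (e : R).

Let size_succs u x : size [seq u y | y <- succs x] = m.
Proof. by rewrite 2!size_map size_enum_ord. Qed.

(** A shift by [e] moves the maximum and the minimum by [e] and the sum by [m * e], hence the
    average by [alpha * e + beta * e = e]. The sign of [e] is free, which [exists_succ_ge] relies
    on. *)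
Lemma dp_op_le u v x e :
  (forall a, u (rcons x a) <= v (rcons x a) + e) ->
  dp_op alpha beta u x <= dp_op alpha beta v x + e.
Proof.
move=> uv.
have hM : lmax [seq u y | y <- succs x] <= lmax [seq v y | y <- succs x] + e.
  apply: lmax_le => [|_ /mapP[_ /mapP[a _ ->] ->]]; first by rewrite size_succs.
  rewrite (le_trans (uv a)) // lerD2r; apply: lmax_ge.
  by rewrite map_f // map_f // mem_enum.
have hm : lmin [seq u y | y <- succs x] <= lmin [seq v y | y <- succs x] + e.
  rewrite -lerBlDr; apply: lmin_ge => [|_ /mapP[_ /mapP[a _ ->] ->]].
    by rewrite size_succs.
  rewrite lerBlDr (le_trans _ (uv a)) //; apply: lmin_le.
  by rewrite map_f // map_f // mem_enum.
have hS : \sum_(y <- succs x) u y <= \sum_(y <- succs x) v y + m%:R * e.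
  have sumE (w : vertex m -> R) : \sum_(y <- succs x) w y = \sum_a w (rcons x a).
    by rewrite big_map big_enum.
  rewrite !sumE.
  rewrite (_ : m%:R * e = \sum_(a < m) e) -?big_split; first exact: ler_sum.
  by rewrite sumr_const card_ord mulr_natl.
have a2 : 0 <= alpha / 2 by rewrite divr_ge0.
have bm : 0 <= beta / m%:R by rewrite divr_ge0.
have := ler_wpM2l a2 (lerD hM hm); have := ler_wpM2l bm hS.
have -> (s : R) : beta / m%:R * (s + m%:R * e) = beta / m%:R * s + beta * e.
  by rewrite mulrDr mulrA divfK // pnatr_eq0 -lt0n.
have : alpha * e + beta * e = e by rewrite -mulrDl alphaDbeta mul1r.
by rewrite /dp_op; lra.
Qed.

Lemma dp_op_const u x c :
  (forall a, u (rcons x a) = c) -> dp_op alpha beta u x = c.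
Proof.
move=> uc.
have E : [seq u y | y <- succs x] = nseq m c.
  rewrite -[in RHS](size_succs u x); apply/all_pred1P/allP.
  by move=> _ /mapP[_ /mapP[a _ ->] ->]; rewrite /= uc.
have cm : c \in nseq m c by rewrite mem_nseq m_gt0 eqxx.
have lec : {in nseq m c, forall a, a = c} by move=> a /nseqP[].
have hM : lmax (nseq m c) = c.
  apply/eqP; rewrite eq_le lmax_ge // andbT.
  by apply: lmax_le; rewrite ?size_nseq // => a /lec ->.
have hm : lmin (nseq m c) = c.
  apply/eqP; rewrite eq_le lmin_le //=.
  by apply: lmin_ge; rewrite ?size_nseq // => a /lec ->.
have hS : \sum_(y <- succs x) u y = m%:R * c.
  by rewrite -[LHS](big_map u xpredT id) E big_nseq iter_addr_0 mulr_natl.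
rewrite /dp_op E hM hm hS mulrDr -mulrDl -splitr mulrA divfK ?pnatr_eq0 -?lt0n //.
by rewrite -mulrDl alphaDbeta mul1r.
Qed.

Lemma p_harmonious_cst c : p_harmonious alpha beta (fun _ : vertex m => c).
Proof. by move=> x; exact/esym/dp_op_const. Qed.

Lemma p_harmonious_le_level u v k e :
  p_harmonious alpha beta u -> p_harmonious alpha beta v ->
  (forall x, (k <= size x)%N -> u x <= v x + e) ->
  forall x, u x <= v x + e.
Proof.
move=> hu hv kuv x.
have : (k <= size x + k)%N by rewrite leq_addl.
(* Backward induction from level [k] to the root: only the second [k] is generalised, to the number
   [j] of levels that may separate [x] from level [k]. *)
elim: {2}k x => [|j IH] x; first by rewrite addn0; exact: kuv.
rewrite addnS -addSn => kj; rewrite hu hv; apply: dp_op_le => a.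
by apply: IH; rewrite size_rcons.
Qed.

Lemma p_harmonious_dist_level u v k e :
  p_harmonious alpha beta u -> p_harmonious alpha beta v ->
  (forall x, (k <= size x)%N -> `|u x - v x| <= e) ->
  forall x, `|u x - v x| <= e.
Proof.
move=> hu hv kuv x; rewrite ler_distlC lerBlDr; apply/andP; split.
  apply: (p_harmonious_le_level (k := k)) => // y /kuv.
  by rewrite ler_distlC => /andP[]; lra.
apply: (p_harmonious_le_level (k := k)) => // y /kuv.
by rewrite ler_distlC => /andP[]; lra.
Qed.

(** Take the successor with the largest difference [w a]: then [u] is at most [v + w a] on all
    successors, and averaging carries this bound to [x]. *)
Lemma exists_succ_ge u v x :
  p_harmonious alpha beta u -> p_harmonious alpha beta v ->
  exists a, u x - v x <= u (rcons x a) - v (rcons x a).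
Proof.
move=> hu hv; pose w a := u (rcons x a) - v (rcons x a).
case: (@arg_maxP _ _ _ (Ordinal m_gt0) xpredT w isT) => a _ wa; exists a.
rewrite lerBlDl hu hv; apply: dp_op_le => c.
by have : w c <= w a by [exact: wa]; rewrite /w; lra.
Qed.

(* If u - v were positive at x, one could descend from x to infinity along
   successors that do not decrease u - v. *)
Lemma p_harmonious_le_boundary u v :
  p_harmonious alpha beta u -> p_harmonious alpha beta v ->
  (forall b, (u (branch_vertex b k) - v (branch_vertex b k)) @[k --> \oo]
               --> (0 : R)) ->
  forall x, u x <= v x.
Proof.
move=> hu hv uv0 x; rewrite leNgt; apply/negP => vux.
have [next nextP] := choice (fun y => exists_succ_ge y hu hv).
pose X k := iter k (fun y => rcons y (next y)) x.
(* Digit [i] is read off the descent path [X] one step later, at a vertex of length [size x + i.+1],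
   so the default [next x] is never returned. *)
pose b i := nth (next x) (X i.+1) i.
have sX k : size (X k) = (size x + k)%N.
  by elim: k => [|k IH]; rewrite ?addn0 // /= size_rcons IH addnS.
have X_nth k j i : (i < size x + k)%N ->
    nth (next x) (X (j + k)%N) i = nth (next x) (X k) i.
  move=> ik; elim: j => [//|j IH]; rewrite addSn [X _.+1]/= nth_rcons.
  by rewrite sX (leq_trans ik) ?leq_add2l ?leq_addl.
have bX k : branch_vertex b (size x + k) = X k.
  apply: (@eq_from_nth _ (next x)) => [|i]; rewrite size_mkseq ?sX // => ik.
  (* Both digits are compared with the one at the common later vertex [X (i.+1 + k)]. *)
  rewrite nth_mkseq // /b -(X_nth i.+1 k) ?leq_addl //.
  by rewrite addnC X_nth.
have wX k : u x - v x <= u (X k) - v (X k).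
  by elim: k => [//|k IH]; exact: le_trans IH (nextP _).
have d0 : 0 < (u x - v x) / 2 by lra.
(* At level [size x + N] the branch passes through [X N], where the difference is at least
   [u x - v x] and yet at most half of it. *)
have [N _ /(_ (size x + N)%N (leq_addl _ _)) /=] :=
  (cvgrPdist_le _ _).1 (uv0 b) _ d0.
rewrite bX sub0r normrN ger0_norm; have := wX N; lra.
Qed.


Lemma approximant_deepE (F : R -> R) n (x : vertex m) : (n <= size x)%N ->
  approximant alpha beta F n x = F (psi (take n x)).
Proof. by move=> nx; rewrite /approximant (eqP (nx : (n - size x == 0)%N)). Qed.

(* Below level n the function is constant on subtrees, so it is p-harmonious
   at every vertex, not only where it is defined by recursion. *)
Lemma approximant_p_harmonious (F : R -> R) n :
  p_harmonious alpha beta (approximant alpha beta F n : vertex m -> R).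
Proof.
move=> x; have [nx|xn] := leqP n (size x); last exact: approximant_shallow.
rewrite [RHS](dp_op_const (c := F (psi (take n x)))).
  by rewrite approximant_deepE.
by move=> a; rewrite approximant_deepE ?size_rcons 1?leqW // -cats1 takel_cat.
Qed.

End Harmonic.

(** * Convergence of the approximants and properties of the limit *)

Section Approximation.
Context {R : realType} {m : nat}.
Variables (alpha beta : R) (F : R -> R).
Hypotheses (m_gt1 : (1 < m)%N) (alpha_ge0 : 0 <= alpha) (beta_ge0 : 0 <= beta).
Hypothesis alphaDbeta : alpha + beta = 1.
Hypothesis Fcont : {within `[0, 1], continuous F}.
Let m_gt0 : (0 < m)%N := ltnW m_gt1.
Let a_ n : vertex m -> R := approximant alpha beta F n.
Let a_harm n : p_harmonious alpha beta (a_ n).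
Proof. exact: approximant_p_harmonious. Qed.

(** The modulus of continuity of [F] at scale [m^-n] is at most [e]. Continuity and the Lipschitz
    condition both enter the error estimates in this form. *)
Definition scale_modulus n (e : R) := forall s t : R,
  `[0, 1]%classic s -> `[0, 1]%classic t -> `|s - t| <= m%:R ^- n ->
  `|F s - F t| <= e.

Lemma scale_modulus_small (e : R) : 0 < e ->
  exists N, forall n, (N <= n)%N -> scale_modulus n e.
Proof.
move=> e0; have [d d0 dP] :=
  compact_unif_continuous (@segment_compact R 0 1) Fcont e0.
have [N Nd] := expfV_small m_gt1 d0; exists N => n Nn s t s01 t01 st.
by apply: dP => //; rewrite (le_trans st) ?Nd.
Qed.

Lemma approximant_dist n k e x : (n <= k)%N -> scale_modulus n e ->
  `|a_ n x - a_ k x| <= e.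
Proof.
move=> nk ne; apply: (p_harmonious_dist_level m_gt0 alpha_ge0 beta_ge0 alphaDbeta
  (a_harm n) (a_harm k) (k := k)) => y ky.
rewrite /a_ !approximant_deepE ?(leq_trans nk) //; apply: ne; try exact: psi_itv.
(* As [n <= k], [take n y] is the truncation of [take k y] to length [n]. *)
by rewrite -[in take n y](minn_idPl nk) take_min psi_take_dist.
Qed.

Definition dp_limit (x : vertex m) : R := limn (fun n => a_ n x).

Lemma is_cvg_approximant x : cvgn (fun n => a_ n x).
Proof.
apply: cvgn_cauchy_le => e /scale_modulus_small[N Ne]; exists N => k Nk.
by apply: approximant_dist => //; exact: Ne.
Qed.

Lemma approximant_limit_dist n e x : scale_modulus n e ->
  `|a_ n x - dp_limit x| <= e.
Proof.
move=> ne; apply: (norm_sub_limn_le (a := fun n => a_ n x)).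
  exact: is_cvg_approximant.
by move=> k nk; exact: approximant_dist.
Qed.

(** The operator does not increase uniform distance, so replacing the limit by [a_ N] costs [e / 2]
    on each side of the equation. *)
Lemma dp_limit_p_harmonious : p_harmonious alpha beta dp_limit.
Proof.
move=> x; apply/eqP; rewrite -subr_eq0 -normr_le0.
apply/ler_addgt0Pr => e e0; rewrite add0r.
have e2 : 0 < e / 2 by lra.
have [N Ne] := scale_modulus_small e2.
have ae y := approximant_limit_dist y (Ne N (leqnn N)).
have h1 : dp_op alpha beta dp_limit x <= dp_op alpha beta (a_ N) x + e / 2.
  by apply: dp_op_le => // a; have := ae (rcons x a); rewrite ler_distl; lra.
have h2 : dp_op alpha beta (a_ N) x <= dp_op alpha beta dp_limit x + e / 2.
  by apply: dp_op_le => // a; have := ae (rcons x a); rewrite ler_distl; lra.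
by have := ae x; rewrite !ler_distl (a_harm N x); lra.
Qed.

Lemma dp_limit_bounded : bounded_fun dp_limit.
Proof.
have [N N1] := scale_modulus_small (@ltr01 R).
have /compact_bounded[M [Mr MF]] : compact (F @` `[0, 1]).
  by apply: continuous_compact Fcont _; exact: segment_compact.
have FM s : `[0, 1]%classic s -> `|F s| <= M + 1.
  by move=> s01; apply: (MF (M + 1)); [lra | exists s].
(* Comparison with the constant 0 below level [N] bounds [a_ N] by [M + 1]; its distance to the
   limit adds at most 1. *)
exists (M + 2); split; first exact: num_real.
move=> K MK x _ /=.
have aM : `|a_ N x - 0| <= M + 1.
  apply: (p_harmonious_dist_level m_gt0 alpha_ge0 beta_ge0 alphaDbeta
    (a_harm N) (p_harmonious_cst m_gt0 alphaDbeta 0) (k := N)) => y Ny.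
  by rewrite subr0 /a_ approximant_deepE // FM //; exact: psi_itv.
have := approximant_limit_dist x (N1 N (leqnn N)).
rewrite subr0 in aM; have := ler_distD (a_ N x) 0 (dp_limit x).
by rewrite !sub0r !normrN; lra.
Qed.

(** At the [k]-th vertex the limit is compared with the approximant of the same index [k], whose
    value there is exactly [F] at the left endpoint. What remains is the increment of [F] from that
    endpoint to [branch_psi b], at most [m^-k] away. *)
Lemma dp_limit_boundary (b : nat -> 'I_m) :
  dp_limit (branch_vertex b k) @[k --> \oo] --> F (branch_psi b).
Proof.
apply/cvgrPdist_le => e e0; have e2 : 0 < e / 2 by lra.
have [N Ne] := scale_modulus_small e2; exists N => // k /= Nk.
have := approximant_limit_dist (branch_vertex b k) (Ne k Nk).
rewrite /a_ approximant_deepE ?size_mkseq // take_oversize ?size_mkseq // => h1.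
have := Ne k Nk _ _ (psi_itv m_gt1 (branch_vertex b k))
  (branch_psi_itv m_gt1 b) (branch_psi_dist m_gt1 b k).
rewrite distrC => h2; rewrite (le_trans (ler_distD (F (psi (branch_vertex b k))) _ _)) //.
by rewrite (le_trans (lerD h2 h1)) // -splitr.
Qed.

Lemma dp_limit_solution : dp_solution alpha beta F dp_limit.
Proof.
split; [exact: dp_limit_bounded | exact: dp_limit_p_harmonious |].
exact: dp_limit_boundary.
Qed.

(** The common boundary values make [u - v] tend to 0 along every branch. Exchanging [u] and [v]
    gives uniqueness. *)
Lemma dp_solution_le u v : dp_solution alpha beta F u ->
  dp_solution alpha beta F v -> forall x : vertex m, u x <= v x.
Proof.
move=> [_ hu bu] [_ hv bv]; apply: (p_harmonious_le_boundary m_gt0 alpha_ge0 beta_ge0 alphaDbeta hu hv) => b.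
by rewrite -(subrr (F (branch_psi b))); apply: cvgB; [exact: bu|exact: bv].
Qed.

Lemma approximant_cvg_uniform : {uniform, a_ @ \oo --> dp_limit}.
Proof.
move=> P /uniform_nbhs[E [/= entE EP]].
move: entE; rewrite -entourage_ballE => -[e /= e0 eE].
have e2 : 0 < e / 2 by lra.
have [N Ne] := scale_modulus_small e2; exists N => // n /= Nn.
apply: EP => x _; apply: eE => /=; rewrite /ball /= distrC.
by rewrite (le_lt_trans (approximant_limit_dist x (Ne n Nn))) //; lra.
Qed.

Lemma lipschitz_scale_modulus L n : L.-lipschitz_(`[0, 1]) F ->
  scale_modulus n (L / m%:R ^+ n).
Proof.
move=> FL; have Ld s t : `[0, 1]%classic s -> `[0, 1]%classic t ->
    `|F s - F t| <= L * `|s - t| by move=> s01 t01; exact: (FL (s, t)).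
(* The Lipschitz bound at the points 1 and 0 forces [L] to be nonnegative, so [L] times a distance
   grows with the distance. *)
have L0 : 0 <= L.
  have := Ld 1 0; rewrite subr0 normr1 mulr1 /= !in_itv /= !lexx ler01.
  by move=> /(_ isT isT); exact: le_trans.
by move=> s t s01 t01 st; rewrite (le_trans (Ld s t _ _)) // ler_wpM2l.
Qed.

End Approximation.

Theorem theorem4p2 (R : realType) (m : nat) (alpha beta : R) (F : R -> R)
    (m_gt2 : (2 < m)%N) (alpha_gt0 : 0 < alpha) (beta_gt0 : 0 < beta)
    (alphaDbeta : alpha + beta = 1)
    (Fcont : {within `[0, 1], continuous F}) :
  exists u : vertex m -> R,
    [/\ dp_solution alpha beta F u,
        forall v : vertex m -> R, dp_solution alpha beta F v -> v = u,
        {uniform, approximant alpha beta F @ \oo --> u} &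
        forall L : R, L.-lipschitz_(`[0, 1]) F ->
          forall (n : nat) (x : vertex m), (0 < n)%N ->
            `|approximant alpha beta F n x - u x| <= L / m%:R ^+ n].
Proof.
have m_gt1 : (1 < m)%N by exact: ltnW.
have a0 := ltW alpha_gt0; have b0 := ltW beta_gt0.
have sol := dp_limit_solution m_gt1 a0 b0 alphaDbeta Fcont.
exists (dp_limit alpha beta F); split => //.
- move=> v vsol; apply/funext => x; apply/eqP; rewrite eq_le.
  by rewrite !(dp_solution_le (F := F) m_gt1 a0 b0 alphaDbeta).
- exact: approximant_cvg_uniform.
- move=> L FL n x _; apply: approximant_limit_dist => //.
  exact: lipschitz_scale_modulus.
Qed.
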